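(* Let $\mathrm{F}_2$ be the free group of rank $2$ and let $\mathcal{L}_{\mathrm{F}_2}$ be the universal sub-line bundle on $\mathrm{Rep}_2(\mathrm{F}_2)_B$. Then $\mathcal{L}_{\mathrm{F}_2}^{\otimes 2}\cong \mathcal{O}_{\mathrm{Rep}_2(\mathrm{F}_2)_B}$.
   Context: Let $X$ be a scheme. A representation of degree $n$ for a group (resp. monoid) $\Gamma$ on $X$ is a group homomorphism $\rho:\Gamma\to \mathrm{GL}_n(\Gamma(X,\mathcal{O}_X))$ (resp. a monoid homomorphism $\rho:\Gamma\to \mathrm{M}_n(\Gamma(X,\mathcal{O}_X))$). A mold of degree $n$ on $X$ is a subsheaf of $\mathcal{O}_X$-algebras (containing the identity matrix) $\mathcal{A}\subseteq \mathrm{M}_n(\mathcal{O}_X)$ such that $\mathcal{A}$ and $\mathrm{M}_n(\mathcal{O}_X)/\mathcal{A}$ are locally free sheaves. Two molds $\mathcal{A},\mathcal{B}$ of degree $n$ on $X$ are locally equivalent if every $x\in X$ has an open neighborhood $U$ and some $P_U\in \mathrm{GL}_n(\mathcal{O}_U)$ with $P_U^{-1}(\mathcal{A}|_U)P_U=\mathcal{B}|_U$. Let $\mathcal{B}_n\subset \mathrm{M}_n(\mathbb{Z})$ be the subalgebra of upper triangular matrices. A Borel mold of degree $n$ on $X$ is a mold locally equivalent to $\mathcal{B}_n\otimes_{\mathbb{Z}}\mathcal{O}_X$. A representation with Borel mold on $X$ is a representation $\rho$ of degree $n$ on $X$ such that the subsheaf of $\mathcal{O}_X$-algebras $\mathcal{O}_X[\rho(\Gamma)]\subseteq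 \mathrm{M}_n(\mathcal{O}_X)$ generated by $\rho(\Gamma)$ is a Borel mold. $\mathrm{Rep}_n(\Gamma)_B$ is the scheme over $\mathbb{Z}$ representing the contravariant functor sending a scheme $X$ to the set of degree $n$ representations with Borel mold for $\Gamma$ on $X$; it is a subscheme of the affine scheme $\mathrm{Rep}_n(\Gamma)$ representing all degree $n$ representations of $\Gamma$. The universal representation makes $\Gamma$ act on the trivial bundle $\mathcal{O}^{\oplus n}_{\mathrm{Rep}_n(\Gamma)_B}$ (via $\mathrm{M}_n(\Gamma(X,\mathcal{O}_X))=\mathrm{End}_{\mathcal{O}_X}(\mathcal{O}_X^{\oplus n})$ with $X=\mathrm{Rep}_n(\Gamma)_B$). A subbundle of $\mathcal{O}_X^{\oplus n}$ is a locally free subsheaf with locally free quotient. For $n=2$ there is a unique $\Gamma$-invariant rank $1$ subbundle $\mathcal{L}_\Gamma\subset \mathcal{O}_{\mathrm{Rep}_2(\Gamma)_B}^{\oplus 2}$, called the universal sub-line bundle on $\mathrm{Rep}_2(\Gamma)_B$. *)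

(* Defs.v *)
From HB Require Import structures.
From mathcomp Require Import all_boot all_order all_algebra.
From mathcomp Require Import all_classical topology.

Set Implicit Arguments.
Unset Strict Implicit.
Unset Printing Implicit Defensive.

Import GRing.Theory.

Local Open Scope classical_set_scope.
Local Open Scope ring_scope.

Identity Coercion set_Funclass : set >-> Funclass.

Record opens (T : topologicalType) := Opens {
  oset :> set T;
  oset_open : open oset }.

Definition otop (T : topologicalType) : opens T := Opens (@openT T).

Lemma sub_otop (T : topologicalType) (U : opens T) : U `<=` otop T.
Proof. by []. Qed.

Definition is_sheaf (T : topologicalType) (F : opens T -> Type)
    (r : forall U V : opens T, V `<=` U -> F U -> F V) : Prop :=
  [/\ forall (U : opens T) (UU : U `<=` U) (s : F U), r U U UU s = s,
      forall (U V W : opens T) (VU : V `<=` U) (WV : W `<=` V) (WU : W `<=` U)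
        (s : F U), r V W WV (r U V VU s) = r U W WU s
    & forall (U : opens T) (I : Type) (C : I -> opens T)
        (CU : forall i, C i `<=` U) (s : forall i, F (C i)),
        (forall x, U x -> exists i, C i x) ->
        (forall i j (V : opens T) (Vi : V `<=` C i) (Vj : V `<=` C j),
            r (C i) V Vi (s i) = r (C j) V Vj (s j)) ->
        exists! t : F U, forall i, r U (C i) (CU i) t = s i].

(* Rings of sections may be zero (on the empty set they must be), whence
   [comPzRingType]. *)
Record ringed_space := RingedSpace {
  rs_top :> topologicalType;
  sec : opens rs_top -> comPzRingType;
  res : forall U V : opens rs_top, V `<=` U -> {rmorphism sec U -> sec V};
  res_sheaf : is_sheaf (fun U V VU => res VU) }.

Arguments res {r U V}.

Definition invertible (A : comPzRingType) (a : A) : Prop :=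
  exists b : A, a * b = 1.

(* The germ of [s] at [x] is a unit of the stalk. *)
Definition unit_germ (X : ringed_space) (U : opens X) (s : sec U) (x : X) :
    Prop :=
  exists (V : opens X) (VU : V `<=` U), V x /\ invertible (res VU s).

Definition prime_ideal (A : comPzRingType) (p : set A) : Prop :=
  [/\ p 0,
      forall a b, p a -> p b -> p (a + b),
      forall a b, p b -> p (a * b),
      ~ p 1
    & forall a b, p (a * b) -> p a \/ p b].

(* [g] exhibits [B] as the localization of [A] at the powers of [f]. *)
Definition is_localization (A B : comPzRingType) (f : A) (g : A -> B) : Prop :=
  [/\ invertible (g f),
      forall b, exists a n, b * g f ^+ n = g a
    & forall a, g a = 0 -> exists n, f ^+ n * a = 0].

(* [pt] is a homeomorphism from [U] onto the prime spectrum of [A] with its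
   Zariski topology, and, through it and [iota], the sections of the structure
   sheaf on the basic open set D(f) are A_f. As a sheaf is determined by its
   restriction to a basis of the topology, this says that [pt] and [iota] form
   an isomorphism of ringed spaces from (U, O_U) to Spec A. *)
Definition is_Spec (X : ringed_space) (U : opens X) (A : comPzRingType)
    (pt : X -> set A) (iota : {rmorphism A -> sec U}) : Prop :=
  [/\ forall x, U x -> prime_ideal (pt x),
      forall x y, U x -> U y -> pt x = pt y -> x = y,
      forall p, prime_ideal p -> exists2 x, U x & pt x = p,
      forall V : set X, V `<=` U ->
        (open V <-> exists E : set A, V = [set x | U x /\ ~ E `<=` pt x])
    & forall (f : A) (D : opens X) (DU : D `<=` U),
        oset D = [set x | U x /\ ~ pt x f] ->
        is_localization f (fun a => res DU (iota a))].

Definition affine (X : ringed_space) (U : opens X) : Prop :=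
  exists (A : comPzRingType) (pt : X -> set A) (iota : {rmorphism A -> sec U}),
    is_Spec pt iota.

(* The stalks of the structure sheaf are automatically local rings. *)
Record scheme := Scheme {
  sch_rs :> ringed_space;
  sch_affine : forall x : sch_rs, exists U : opens sch_rs, U x /\ affine U }.

Definition opreim (S T : topologicalType) (f : S -> T) (cf : continuous f)
    (V : opens T) : opens S :=
  Opens (proj1 (continuousP f) cf V (oset_open V)).

Lemma opreim_sub (S T : topologicalType) (f : S -> T) (cf : continuous f)
    (U V : opens T) : V `<=` U -> opreim cf V `<=` opreim cf U.
Proof. by move=> VU x; exact: VU. Qed.

Lemma otop_opreim (S T : topologicalType) (f : S -> T) (cf : continuous f) :
  otop S `<=` opreim cf (otop T).
Proof. by []. Qed.

(* Morphisms of locally ringed spaces; [mor_local] says that the maps induced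
   on the stalks are local homomorphisms. *)
Record morphism (X Y : scheme) := Morphism {
  mor_fun :> X -> Y;
  mor_cont : continuous mor_fun;
  mor_sec : forall V : opens Y, {rmorphism sec V -> sec (opreim mor_cont V)};
  mor_nat : forall (U V : opens Y) (VU : V `<=` U) (s : sec U),
    mor_sec V (res VU s) = res (opreim_sub (cf := mor_cont) VU) (mor_sec U s);
  mor_local : forall (V : opens Y) (s : sec V) (x : X),
    V (mor_fun x) -> unit_germ (mor_sec V s) x -> unit_germ s (mor_fun x) }.

Arguments mor_cont {X Y} f x A _ : rename.

Definition mor_global (X Y : scheme) (f : morphism X Y)
    (s : sec (otop Y)) : sec (otop X) :=
  res (otop_opreim (mor_cont f)) (mor_sec f (otop Y) s).

Record mod_sheaf (X : ringed_space) := ModSheaf {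
  msec :> forall U : opens X, lmodType (sec U);
  mres : forall U V : opens X, V `<=` U -> msec U -> msec V;
  mresP : forall (U V : opens X) (VU : V `<=` U) (a : sec U) (s t : msec U),
    mres VU (a *: s + t) = res VU a *: mres VU s + mres VU t;
  mres_sheaf : is_sheaf mres }.

Arguments mres {X m U V}.

Record mod_hom (X : ringed_space) (F G : mod_sheaf X) := ModHom {
  mhom :> forall U : opens X, {linear F U -> G U};
  mhom_nat : forall (U V : opens X) (VU : V `<=` U) (s : F U),
    mhom V (mres VU s) = mres VU (mhom U s) }.

Definition mod_iso (X : ringed_space) (F G : mod_sheaf X) : Prop :=
  exists (f : mod_hom F G) (g : mod_hom G F),
    forall U : opens X, cancel (f U) (g U) /\ cancel (g U) (f U).

(* Equivalently, [e] is an isomorphism from O_U^n to the restriction of [F]. *)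
Definition is_basis (X : ringed_space) (F : mod_sheaf X) (U : opens X) (n : nat)
    (e : 'I_n -> F U) : Prop :=
  forall (V : opens X) (VU : V `<=` U) (s : F V),
    exists! a : 'I_n -> sec V, s = \sum_i a i *: mres VU (e i).

Definition locally_free_rank (X : ringed_space) (F : mod_sheaf X) (n : nat) :
    Prop :=
  forall x : X, exists (U : opens X) (e : 'I_n -> F U), U x /\ is_basis e.

(* The rank is finite, but need not be constant. *)
Definition locally_free (X : ringed_space) (F : mod_sheaf X) : Prop :=
  forall x : X, exists (U : opens X) (n : nat) (e : 'I_n -> F U),
    U x /\ is_basis e.

Record bilin (X : ringed_space) (F G H : mod_sheaf X) := Bilin {
  bmap :> forall U : opens X, F U -> G U -> H U;
  bmap_linl : forall (U : opens X) (a : sec U) (s s' : F U) (t : G U),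
    bmap (a *: s + s') t = a *: bmap s t + bmap s' t;
  bmap_linr : forall (U : opens X) (a : sec U) (s : F U) (t t' : G U),
    bmap s (a *: t + t') = a *: bmap s t + bmap s t';
  bmap_nat : forall (U V : opens X) (VU : V `<=` U) (s : F U) (t : G U),
    bmap (mres VU s) (mres VU t) = mres VU (bmap s t) }.

(* The tensor product of sheaves of modules is determined, up to a unique
   isomorphism, by its universal property. *)
Definition is_tensor (X : ringed_space) (F G T : mod_sheaf X)
    (b : bilin F G T) : Prop :=
  forall (P : mod_sheaf X) (c : bilin F G P),
    exists! f : mod_hom T P,
      forall (U : opens X) (s : F U) (t : G U), c U s t = f U (b U s t).

Section StructureSheaf.
Variable X : ringed_space.

Lemma str_resP (U V : opens X) (VU : V `<=` U) (a : sec U) (s t : (sec U)^o) :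
  (res VU (a *: s + t) : (sec V)^o)
  = res VU a *: (res VU s : (sec V)^o) + (res VU t : (sec V)^o).
Proof. by rewrite rmorphD; congr (_ + _); rewrite /GRing.scale /= rmorphM. Qed.

Definition str_sheaf : mod_sheaf X :=
  @ModSheaf X (fun U => (sec U)^o) (fun U V VU => res VU) str_resP
    (res_sheaf X).

End StructureSheaf.

Section MatrixSheaf.
Variables (X : ringed_space) (m n : nat).

Definition mx_res (U V : opens X) (VU : V `<=` U) (M : 'M[sec U]_(m, n)) :
  'M[sec V]_(m, n) := map_mx (res VU) M.

Lemma mx_resP (U V : opens X) (VU : V `<=` U) (a : sec U)
    (s t : 'M[sec U]_(m, n)) :
  mx_res VU (a *: s + t) = res VU a *: mx_res VU s + mx_res VU t.
Proof. by apply/matrixP=> i j; rewrite !mxE rmorphD rmorphM. Qed.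

Lemma mx_res_sheaf : is_sheaf mx_res.
Proof.
have [rid rcomp rglue] := res_sheaf X.
split=> [U UU s|U V W VU WV WU s|U I C CU s cov comp].
- by apply/matrixP=> i j; rewrite mxE rid.
- by apply/matrixP=> i j; rewrite !mxE (rcomp _ _ _ VU WV WU).
have glue i j : exists! t : sec U, forall k, res (CU k) t = s k i j.
  apply: (rglue U I C CU (fun k => s k i j) cov) => k l V Vk Vl.
  by have /matrixP/(_ i j) := comp k l V Vk Vl; rewrite !mxE.
have /choice[t tP] i : exists ti : 'I_n -> sec U,
    forall j k, res (CU k) (ti j) = s k i j.
  have /choice[ti tiP] j : exists tij, forall k, res (CU k) tij = s k i j.
    by have [tij [tijP _]] := glue i j; exists tij.
  by exists ti.
exists (\matrix_(i, j) t i j); split=> [k|M MP].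
  by apply/matrixP=> i j; rewrite !mxE tP.
apply/matrixP=> i j; rewrite mxE.
have [tij [_ uniq]] := glue i j.
rewrite -(uniq _ (tP i j)); apply: uniq => k.
by rewrite -MP mxE.
Qed.

Definition mx_sheaf : mod_sheaf X :=
  @ModSheaf X (fun U => 'M[sec U]_(m, n)) mx_res mx_resP mx_res_sheaf.

End MatrixSheaf.

Definition free_sheaf (X : ringed_space) (n : nat) : mod_sheaf X :=
  mx_sheaf X n 1.

Record submod (X : ringed_space) (F : mod_sheaf X) := Submod {
  sub_sec :> forall U : opens X, set (F U);
  sub0 : forall U : opens X, @sub_sec U 0;
  subP : forall (U : opens X) (a : sec U) (s t : F U),
    @sub_sec U s -> @sub_sec U t -> @sub_sec U (a *: s + t);
  sub_res : forall (U V : opens X) (VU : V `<=` U) (s : F U),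
    @sub_sec U s -> @sub_sec V (mres VU s);
  sub_local : forall (U : opens X) (s : F U),
    (forall x, U x -> exists (V : opens X) (VU : V `<=` U),
        V x /\ @sub_sec V (mres VU s)) ->
    @sub_sec U s }.

Arguments sub_sec {X F} S U _ : rename.

Section SubSheaf.
Variables (X : ringed_space) (F : mod_sheaf X) (S : submod F).

Definition sub_pred (U : opens X) : {pred F U} := fun s => `[< S U s >].

Arguments sub_pred : clear implicits.

Lemma sub_predP (U : opens X) : submod_closed (sub_pred U).
Proof.
split=> [|a s t /asboolP Ss /asboolP St]; apply/asboolP; first exact: sub0.
exact: subP.
Qed.

HB.instance Definition _ (U : opens X) :=
  GRing.isSubmodClosed.Build (sec U) (F U) (sub_pred U) (@sub_predP U).

Definition sub_type (U : opens X) : Type := {s : F U | s \in sub_pred U}.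

HB.instance Definition _ (U : opens X) := SubChoice.on (sub_type U).
HB.instance Definition _ (U : opens X) :=
  [SubChoice_isSubLmodule of sub_type U by <:].

Lemma sub_typeP (U : opens X) (s : sub_type U) : S U (val s).
Proof. by apply/asboolP; exact: (valP s). Qed.

Definition sub_mk (U : opens X) (s : F U) (Ss : S U s) : sub_type U :=
  exist _ s (asboolT Ss).

Definition sub_type_res (U V : opens X) (VU : V `<=` U) (s : sub_type U) :
  sub_type V := sub_mk (sub_res VU (sub_typeP s)).

Lemma sub_type_resP (U V : opens X) (VU : V `<=` U) (a : sec U)
    (s t : sub_type U) :
  sub_type_res VU (a *: s + t)
  = res VU a *: sub_type_res VU s + sub_type_res VU t.
Proof. by apply: val_inj; rewrite /= mresP. Qed.

Lemma sub_type_sheaf : is_sheaf sub_type_res.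
Proof.
have [rid rcomp rglue] := mres_sheaf F.
split=> [U UU s|U V W VU WV WU s|U I C CU s cov comp].
- by apply: val_inj; rewrite /= rid.
- by apply: val_inj; rewrite /= (rcomp _ _ _ VU WV WU).
have [|t [tP tuniq]] := rglue U I C CU (fun i => val (s i)) cov.
  by move=> i j V Vi Vj; have /(congr1 val) := comp i j V Vi Vj.
have St : S U t.
  apply: sub_local => x /cov[i Cx]; exists (C i), (CU i); split=> //.
  by rewrite tP; exact: sub_typeP.
exists (sub_mk St); split=> [i|t' t'P]; apply: val_inj => //=.
by apply: tuniq => i; rewrite -t'P.
Qed.

Definition sub_sheaf : mod_sheaf X :=
  @ModSheaf X sub_type sub_type_res sub_type_resP sub_type_sheaf.

End SubSheaf.

(* [p] is an epimorphism of sheaves with kernel [S], so that it identifies [Q]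
   with the quotient sheaf F/S. *)
Definition is_quotient (X : ringed_space) (F : mod_sheaf X) (S : submod F)
    (Q : mod_sheaf X) (p : mod_hom F Q) : Prop :=
  (forall (U : opens X) (s : F U), S U s <-> p U s = 0) /\
  (forall (U : opens X) (q : Q U) (x : X), U x ->
     exists (V : opens X) (VU : V `<=` U) (s : F V),
       V x /\ p V s = mres VU q).

Definition locally_free_quotient (X : ringed_space) (F : mod_sheaf X)
    (S : submod F) : Prop :=
  exists (Q : mod_sheaf X) (p : mod_hom F Q),
    is_quotient S p /\ locally_free Q.

Definition subalgebra (X : ringed_space) (n : nat)
    (A : submod (mx_sheaf X n n)) : Prop :=
  forall U : opens X,
    A U 1%:M /\ (forall M N : 'M[sec U]_n, A U M -> A U N -> A U (M *m N)).

Definition mold (X : ringed_space) (n : nat) (A : submod (mx_sheaf X n n)) :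
    Prop :=
  [/\ subalgebra A, locally_free (sub_sheaf A) & locally_free_quotient A].

(* The sections of [A] and [B] over the open subsets V of U satisfy
   P^-1 A(V) P = B(V); here [Q] is the inverse of [P]. *)
Definition locally_equivalent (X : ringed_space) (n : nat)
    (A B : submod (mx_sheaf X n n)) : Prop :=
  forall x : X, exists (U : opens X) (P Q : 'M[sec U]_n),
    [/\ U x, P *m Q = 1%:M, Q *m P = 1%:M
      & forall (V : opens X) (VU : V `<=` U),
          [set mx_res VU Q *m M *m mx_res VU P | M in A V] = B V].

Section UpperTriangular.
Variables (X : ringed_space) (n : nat).

Definition upper_tri (U : opens X) : set (mx_sheaf X n n U) :=
  fun M : 'M[sec U]_n => forall i j : 'I_n, (j < i)%N -> M i j = 0.

Lemma upper_tri0 (U : opens X) : upper_tri (0 : mx_sheaf X n n U).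
Proof. by move=> i j _; rewrite mxE. Qed.

Lemma upper_triP (U : opens X) (a : sec U) (M N : mx_sheaf X n n U) :
  upper_tri M -> upper_tri N -> upper_tri (a *: M + N).
Proof.
by move=> uM uN i j ji; rewrite !mxE (uM _ _ ji) (uN _ _ ji) mulr0 addr0.
Qed.

Lemma upper_tri_res (U V : opens X) (VU : V `<=` U) (M : mx_sheaf X n n U) :
  upper_tri M -> upper_tri (mres VU M).
Proof. by move=> uM i j ji; rewrite mxE (uM _ _ ji) rmorph0. Qed.

Lemma upper_tri_local (U : opens X) (M : mx_sheaf X n n U) :
  (forall x, U x -> exists (V : opens X) (VU : V `<=` U),
      V x /\ upper_tri (mres VU M)) ->
  upper_tri M.
Proof.
move=> loc i j ji; have [_ _ rglue] := res_sheaf X.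
have /choice[V VP] (x : {x | U x}) :
    exists V : opens X, V `<=` U /\ V (sval x) /\
      forall VU : V `<=` U, res VU (M i j) = 0.
  have [V [VU [Vx VM]]] := loc _ (svalP x); exists V; split=> //; split=> // VU'.
  by rewrite (Prop_irrelevance VU' VU); have := VM i j ji; rewrite mxE.
have CU x : V x `<=` U by have [] := VP x.
have [||t [_ tuniq]] := rglue U _ V CU (fun=> 0).
- by move=> x Ux; exists (exist _ x Ux); have [_ []] := VP (exist _ x Ux).
- by move=> k l W Wk Wl; rewrite !rmorph0.
rewrite -(tuniq (M i j)); last by move=> x; have [_ [_]] := VP x; apply.
by apply: tuniq => x; rewrite rmorph0.
Qed.

(* This is B_n ⊗_Z O_X, where B_n is the Z-algebra of upper triangular integral
   matrices: B_n is free on the matrix units E_ij with i <= j, so that the map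
   to M_n(O_X) is injective with these sections as image. *)
Definition upper_tri_mold : submod (mx_sheaf X n n) :=
  Submod upper_tri0 upper_triP upper_tri_res upper_tri_local.

End UpperTriangular.

Definition Borel_mold (X : ringed_space) (n : nat)
    (A : submod (mx_sheaf X n n)) : Prop :=
  mold A /\ locally_equivalent A (upper_tri_mold X n).

(* As the source is a group, all the [rho g] are invertible, so that these are
   the group homomorphisms to GL_n. *)
Definition representation (G : groupType) (X : ringed_space) (n : nat)
    (rho : G -> 'M[sec (otop X)]_n) : Prop :=
  rho 1%g = 1%:M /\ forall g h : G, rho (g * h)%g = rho g *m rho h.

Section GeneratedAlgebra.
Variables (G : Type) (X : ringed_space) (n : nat).
Variable rho : G -> 'M[sec (otop X)]_n.

Definition alg_contains (A : submod (mx_sheaf X n n)) : Prop :=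
  subalgebra A /\ forall g (U : opens X), A U (mx_res (@sub_otop _ U) (rho g)).

Definition gen_sec (U : opens X) : set (mx_sheaf X n n U) :=
  fun M => forall A : submod (mx_sheaf X n n), alg_contains A -> A U M.

Lemma gen_sec0 (U : opens X) : gen_sec (0 : mx_sheaf X n n U).
Proof. by move=> A _; exact: sub0. Qed.

Lemma gen_secP (U : opens X) (a : sec U) (M N : mx_sheaf X n n U) :
  gen_sec M -> gen_sec N -> gen_sec (a *: M + N).
Proof. by move=> gM gN A hA; apply: subP; [exact: gM|exact: gN]. Qed.

Lemma gen_sec_res (U V : opens X) (VU : V `<=` U) (M : mx_sheaf X n n U) :
  gen_sec M -> gen_sec (mres VU M).
Proof. by move=> gM A hA; apply: sub_res; exact: gM. Qed.

Lemma gen_sec_local (U : opens X) (M : mx_sheaf X n n U) :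
  (forall x, U x -> exists (V : opens X) (VU : V `<=` U),
      V x /\ gen_sec (mres VU M)) ->
  gen_sec M.
Proof.
move=> loc A hA; apply: sub_local => x Ux.
by have [V [VU [Vx gM]]] := loc x Ux; exists V, VU; split=> //; exact: gM.
Qed.

(* O_X[rho(G)]. *)
Definition gen_algebra : submod (mx_sheaf X n n) :=
  Submod gen_sec0 gen_secP gen_sec_res gen_sec_local.

End GeneratedAlgebra.

Definition Borel_rep (G : groupType) (X : ringed_space) (n : nat)
    (rho : G -> 'M[sec (otop X)]_n) : Prop :=
  representation rho /\ Borel_mold (gen_algebra rho).

(* [X] is Rep_n(G)_B and [rho] the universal representation: by Yoneda's lemma,
   a representation of the functor is such a universal element. *)
Definition represents_Borel (G : groupType) (n : nat) (X : scheme)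
    (rho : G -> 'M[sec (otop X)]_n) : Prop :=
  Borel_rep rho /\
  forall (Y : scheme) (sigma : G -> 'M[sec (otop Y)]_n), Borel_rep sigma ->
    exists! f : morphism Y X,
      forall g, map_mx (mor_global f) (rho g) = sigma g.

Definition invariant (G : groupType) (X : ringed_space) (n : nat)
    (rho : G -> 'M[sec (otop X)]_n) (L : submod (free_sheaf X n)) : Prop :=
  forall (g : G) (U : opens X) (v : 'cV[sec U]_n),
    L U v -> L U (mx_res (@sub_otop _ U) (rho g) *m v).

(* For the universal representation with Borel mold of degree 2, there is
   exactly one such [L]. *)
Definition universal_sub_line_bundle (G : groupType) (X : ringed_space)
    (rho : G -> 'M[sec (otop X)]_2) (L : submod (free_sheaf X 2)) : Prop :=
  [/\ locally_free_rank (sub_sheaf L) 1, locally_free_quotient L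
    & invariant rho L].

Definition free_group (I : Type) (G : groupType) (x : I -> G) : Prop :=
  forall (H : groupType) (y : I -> H),
    exists! f : G -> H,
      {morph f : g h / (g * h)%g} /\ forall i, f (x i) = y i.

(* Main.v *)
(* Write A, B for the images of the two generators and C = AB - BA. On the line
   bundle L the group acts by scalars, so C kills L; as C has trace 0, it has
   locally the form u e e^T J, where e generates L and J is the symplectic
   matrix (intrinsically, C is a section of
   Hom(O^2 / L, L) = L^2 ⊗ det(O^2)^-1 = L^2). It vanishes nowhere, i.e. u is a
   unit: at a point where C = 0 the algebra generated by the representation
   would be commutative, but the upper triangular matrices are not. Hence
   s t^T J = b(s, t) C defines a perfect pairing b : L x L -> O. *)
Require Import Defs.
From HB Require Import structures.
From mathcomp Require Import all_boot all_order all_algebra ring.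
From mathcomp Require Import all_classical topology.

Set Implicit Arguments.
Unset Strict Implicit.
Unset Printing Implicit Defensive.

Import GRing.Theory.

Local Open Scope classical_set_scope.
Local Open Scope ring_scope.

(** * Induction over a free group *)

Section FreeGroup.
Variables (G : groupType) (P : set G).
Hypotheses (P1 : P 1%g) (PM : forall g h, P g -> P h -> P (g * h)%g)
  (PV : forall g, P g -> P g^-1%g).

Let Pb : {pred G} := fun g => `[< P g >].

Let Pb_closed : group_closed Pb.
Proof.
split=> [|g h /asboolP Pg /asboolP Ph]; apply/asboolP => //.
by apply: PM => //; apply: PV.
Qed.

Let H : Type := {g : G | g \in Pb}.
HB.instance Definition _ := SubChoice.on H.
HB.instance Definition _ := @SubChoice_isSubGroup.Build G Pb H Pb_closed.

(** The elements satisfying [P] form a subgroup [H]. The universal property gives a homomorphism to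
    [H] fixing the generators; followed by the inclusion it is the identity, by uniqueness. *)
Lemma free_group_ind (I : Type) (x : I -> G) :
  free_group x -> (forall i, P (x i)) -> forall g, P g.
Proof.
move=> free Px g.
pose y i : H := exist _ (x i) (asboolT (Px i)).
have [f [[fM fx] _]] := free H y.
have [i0 [_ uniq]] := free G x.
have <- : val (f g) = g.
  transitivity (i0 g); last by apply: (congr1 (@^~ g)); apply: uniq.
  rewrite (_ : i0 = val \o f) //; apply: uniq.
  split=> [a b /=|i /=]; first by rewrite fM.
  by rewrite fx.
by apply/asboolP; exact: (valP (f g)).
Qed.

End FreeGroup.

(** * Extensionality of morphisms of module sheaves *)

Lemma linear_ext (R : pzRingType) (U V : lmodType R) (f g : {linear U -> V}) :
  f =1 g -> f = g.
Proof.
case: f => f [[fA] [fZ]]; case: g => g [[gA] [gZ]] /= /funext fg.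
case: _ / fg in gA gZ *.
by rewrite (Prop_irrelevance fA gA) (Prop_irrelevance fZ gZ).
Qed.

(** The uniqueness clause of [is_tensor] is an equality of records, so the proofs of linearity and
    naturality have to be identified too. *)
Lemma mod_hom_ext (X : ringed_space) (F G : mod_sheaf X) (f g : mod_hom F G) :
  (forall U (s : F U), f U s = g U s) -> f = g.
Proof.
case: f => f fn; case: g => g gn /= fg.
have {}fg : f = g.
  by apply: functional_extensionality_dep => U; exact/linear_ext/fg.
by case: _ / fg in gn *; rewrite (Prop_irrelevance fn gn).
Qed.

(** * Restriction and gluing of sections *)

Section Sheaves.
Variable X : ringed_space.
Implicit Types U V W : opens X.

Definition opI U V : opens X := Opens (openI (oset_open U) (oset_open V)).

Lemma opIl U V : opI U V `<=` U. Proof. by move=> y []. Qed.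
Lemma opIr U V : opI U V `<=` V. Proof. by move=> y []. Qed.

Lemma finite_shrink (n : nat) (x : X) (V : 'I_n -> opens X) :
  (forall k, V k x) -> exists W, W x /\ forall k, W `<=` V k.
Proof.
move=> Vx.
have nV k : nbhs x (V k : set X).
  by apply: open_nbhs_nbhs; split=> //; exact: oset_open.
have := @filter_forall _ _ _ (nbhs x) (nbhs_filter x) nV.
rewrite nbhsE => -[B [oB Bx] BV].
by exists (Opens oB); split=> // k y /BV; apply.
Qed.

Lemma mres_id (F : mod_sheaf X) U (UU : U `<=` U) (s : F U) : mres UU s = s.
Proof. by have [rid _ _] := mres_sheaf F; exact: rid. Qed.

Lemma mres_comp (F : mod_sheaf X) U V W (VU : V `<=` U) (WV : W `<=` V)
  (WU : W `<=` U) (s : F U) : mres WV (mres VU s) = mres WU s.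
Proof. by have [_ rc _] := mres_sheaf F; exact: rc. Qed.

Lemma res_id U (UU : U `<=` U) (s : sec U) : res UU s = s.
Proof. exact: (@mres_id (str_sheaf X)). Qed.

Lemma res_comp U V W (VU : V `<=` U) (WV : W `<=` V) (WU : W `<=` U)
  (s : sec U) : res WV (res VU s) = res WU s.
Proof. exact: (@mres_comp (str_sheaf X)). Qed.

Lemma mx_res_comp m n U V W (VU : V `<=` U) (WV : W `<=` V) (WU : W `<=` U)
  (M : 'M[sec U]_(m, n)) : mx_res WV (mx_res VU M) = mx_res WU M.
Proof. exact: (@mres_comp (mx_sheaf X m n)). Qed.

Lemma mx_res_id m n U (UU : U `<=` U) (M : 'M[sec U]_(m, n)) : mx_res UU M = M.
Proof. exact: (@mres_id (mx_sheaf X m n)). Qed.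

Lemma mresZ (F : mod_sheaf X) U V (VU : V `<=` U) (a : sec U) (s : F U) :
  mres VU (a *: s) = res VU a *: mres VU s.
Proof.
have mres0 : mres VU (0 : F U) = 0.
  have /eqP := mresP VU 1 (0 : F U) 0.
  by rewrite rmorph1 !scale1r addr0 -subr_eq0 opprD addNKr oppr_eq0 => /eqP.
by rewrite -[a *: s]addr0 mresP mres0 addr0.
Qed.

Lemma mx_resM m n p U V (VU : V `<=` U)
    (A : 'M[sec U]_(m, n)) (B : 'M[sec U]_(n, p)) :
  mx_res VU (A *m B) = mx_res VU A *m mx_res VU B.
Proof. exact: map_mxM. Qed.

Lemma mx_res_tr m n U V (VU : V `<=` U)
    (A : 'M[sec U]_(m, n)) :
  mx_res VU A^T = (mx_res VU A)^T.
Proof. exact/esym/map_trmx. Qed.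

Lemma mx_resZ m n U V (VU : V `<=` U) a
    (A : 'M[sec U]_(m, n)) :
  mx_res VU (a *: A) = res VU a *: mx_res VU A.
Proof. exact: map_mxZ. Qed.

Lemma mres_eq_local (F : mod_sheaf X) U (s t : F U) :
  (forall x, U x -> exists V (VU : V `<=` U), V x /\ mres VU s = mres VU t) ->
  s = t.
Proof.
move=> loc; have [_ rc rglue] := mres_sheaf F.
have /choice[V VP] (x : {x | U x}) :
    exists V : {V : opens X | V `<=` U}, sval V (sval x) /\
      mres (proj2_sig V) s = mres (proj2_sig V) t.
  by have [V [VU ?]] := loc _ (svalP x); exists (exist _ V VU).
have [||r [_ runiq]] := rglue U _ (fun x => sval (V x))
    (fun x => proj2_sig (V x)) (fun x => mres (proj2_sig (V x)) s).
- by move=> x Ux; exists (exist _ x Ux); have [] := VP (exist _ x Ux).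
- move=> i j W Wi Wj.
  by rewrite !(mres_comp _ _ (subset_trans Wi (proj2_sig (V i)))).
rewrite -(runiq s) //; apply: runiq => i.
by have [_ ->] := VP i.
Qed.

(** Uniqueness forces the local solutions to agree on overlaps, so they glue, and locality of [Q]
    carries the property over to the glued section. This yields both the values of the pairing and
    the section through which a bilinear map factors. *)
Lemma mres_glue (F : mod_sheaf X) U (Q : forall V, F V -> Prop) :
  (forall V W (WV : W `<=` V) s, V `<=` U -> Q V s -> Q W (mres WV s)) ->
  (forall V s, V `<=` U ->
     (forall x, V x -> exists W (WV : W `<=` V), W x /\ Q W (mres WV s)) ->
     Q V s) ->
  (forall V s t, V `<=` U -> Q V s -> Q V t -> s = t) ->
  (forall x, U x -> exists V s, [/\ V `<=` U, V x & Q V s]) ->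
  exists s, Q U s.
Proof.
move=> Qres Qloc Quniq Qex; have [_ rc rglue] := mres_sheaf F.
have /choice[V VP] (x : {x | U x}) : exists V : {V : opens X & F V},
    [/\ tag V `<=` U, tag V (sval x) & Q (tag V) (tagged V)].
  have [V [s [*]]] := Qex _ (svalP x).
  by exists (@existT _ (fun V : opens X => F V : Type) V s).
have VU x : tag (V x) `<=` U by have [] := VP x.
have [||r [rP _]] := rglue U _ (fun x => tag (V x)) VU (fun x => tagged (V x)).
- by move=> x Ux; exists (exist _ x Ux); have [] := VP (exist _ x Ux).
- move=> i j W Wi Wj; apply: Quniq; first exact: subset_trans Wi (VU i).
    by apply: Qres; have [] := VP i.
  by apply: Qres; have [] := VP j.
exists r; apply: Qloc => // x Ux.
exists (tag (V (exist _ x Ux))), (VU _); rewrite rP.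
by have [] := VP (exist _ x Ux).
Qed.

End Sheaves.

(** * Matrices commuting modulo an ideal of germs *)

Section LocalIdeal.
Variables (X : ringed_space) (n : nat) (C : 'M[sec (otop X)]_n) (x : X).
Implicit Types U V W : opens X.

(* For x in V: the germ of f at x lies in the ideal of the local ring generated
   by the entries of C. *)
Definition germ_ideal V (f : sec V) : Prop :=
  exists W (WV : W `<=` V), W x /\
    exists a : 'M[sec W]_n, res WV f = \tr (a *m mx_res (@sub_otop _ W) C).

Lemma germ_ideal_res V W (WV : W `<=` V) (f : sec V) :
  W x -> germ_ideal f -> germ_ideal (res WV f).
Proof.
move=> Wx [W' [W'V [W'x [a fa]]]].
exists (opI W W'), (@opIl _ W W'); split=> //; exists (mx_res (@opIr _ W W') a).
have IV : opI W W' `<=` V by move=> y [_ /W'V].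
rewrite (res_comp _ _ IV) -(res_comp W'V (@opIr _ W W') IV) fa.
rewrite -trace_map_mx map_mxM; congr (\tr (_ *m _)).
by rewrite -/(mx_res _ _) (mx_res_comp _ _ (@sub_otop _ _)).
Qed.

Lemma germ_ideal_ext V W (WV : W `<=` V) (f : sec V) :
  germ_ideal (res WV f) -> germ_ideal f.
Proof.
move=> [W' [W'W [W'x [a fa]]]]; exists W', (subset_trans W'W WV); split=> //.
by exists a; rewrite -fa (res_comp _ _ (subset_trans W'W WV)).
Qed.

Lemma germ_ideal0 V : V x -> germ_ideal (0 : sec V).
Proof.
move=> Vx; exists V, (@subset_refl _ V); split=> //; exists 0.
by rewrite mul0mx mxtrace0 rmorph0.
Qed.

Lemma germ_idealM V (a f : sec V) : germ_ideal f -> germ_ideal (a * f).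
Proof.
move=> [W [WV [Wx [b fb]]]]; exists W, WV; split=> //; exists (res WV a *: b).
by rewrite -scalemxAl mxtraceZ -fb rmorphM.
Qed.

Lemma germ_idealD V (f g : sec V) :
  germ_ideal f -> germ_ideal g -> germ_ideal (f + g).
Proof.
move=> [W [WV [Wx [a fa]]]] [W' [W'V [W'x [b gb]]]].
have IV : opI W W' `<=` V by move=> y [/WV].
exists (opI W W'), IV; split=> //.
exists (mx_res (@opIl _ W W') a + mx_res (@opIr _ W W') b).
rewrite mulmxDl mxtraceD rmorphD; congr (_ + _).
  rewrite -(res_comp WV (@opIl _ W W') IV) fa -trace_map_mx map_mxM.
  by congr (\tr (_ *m _)); exact: mx_res_comp.
rewrite -(res_comp W'V (@opIr _ W W') IV) gb -trace_map_mx map_mxM.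
by congr (\tr (_ *m _)); exact: mx_res_comp.
Qed.

Lemma germ_ideal_sum V (I : finType) (f : I -> sec V) :
  V x -> (forall i, germ_ideal (f i)) -> germ_ideal (\sum_i f i).
Proof.
move=> Vx fJ; apply: (big_ind (@germ_ideal V)) => //; first exact: germ_ideal0.
by move=> *; exact: germ_idealD.
Qed.

Definition germ_ideal_mx V (M : 'M[sec V]_n) : Prop :=
  forall i j, germ_ideal (M i j).

Lemma germ_ideal_mx_res V W (WV : W `<=` V) (M : 'M[sec V]_n) :
  W x -> germ_ideal_mx M -> germ_ideal_mx (mx_res WV M).
Proof. by move=> Wx MJ i j; rewrite mxE; exact: germ_ideal_res. Qed.

Lemma germ_ideal_mx_ext V W (WV : W `<=` V) (M : 'M[sec V]_n) :
  germ_ideal_mx (mx_res WV M) -> germ_ideal_mx M.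
Proof.
by move=> MJ i j; have := MJ i j; rewrite mxE; exact: germ_ideal_ext.
Qed.

Lemma germ_ideal_mx0 V : V x -> germ_ideal_mx (0 : 'M[sec V]_n).
Proof. by move=> Vx i j; rewrite mxE; exact: germ_ideal0. Qed.

Lemma germ_ideal_mxD V (M N : 'M[sec V]_n) :
  germ_ideal_mx M -> germ_ideal_mx N -> germ_ideal_mx (M + N).
Proof. by move=> MJ NJ i j; rewrite mxE; exact: germ_idealD. Qed.

Lemma germ_ideal_mxZ V a (M : 'M[sec V]_n) :
  germ_ideal_mx M -> germ_ideal_mx (a *: M).
Proof. by move=> MJ i j; rewrite mxE; exact: germ_idealM. Qed.

Lemma germ_ideal_mxMl V (N M : 'M[sec V]_n) :
  V x -> germ_ideal_mx M -> germ_ideal_mx (N *m M).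
Proof.
move=> Vx MJ i j; rewrite mxE; apply: germ_ideal_sum => // k.
exact: germ_idealM.
Qed.

Lemma germ_ideal_mxMr V (M N : 'M[sec V]_n) :
  V x -> germ_ideal_mx M -> germ_ideal_mx (M *m N).
Proof.
move=> Vx MJ i j; rewrite mxE; apply: germ_ideal_sum => // k.
by rewrite mulrC; exact: germ_idealM.
Qed.

Lemma germ_ideal_mxC : germ_ideal_mx C.
Proof.
move=> i j; exists (otop X), (@subset_refl _ (otop X)); split=> //.
(* tr(E_ji C) = C_ij. *)
exists (delta_mx j i).
rewrite mx_res_id res_id /mxtrace (bigD1 j) //= big1 ?addr0 => [|k kj].
  rewrite mxE (bigD1 i) //= big1 ?addr0 => [|k ki]; rewrite mxE ?eqxx ?mul1r //.
  by rewrite (negPf ki) andbF mul0r.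
by rewrite mxE big1 // => l _; rewrite mxE (negPf kj) mul0r.
Qed.

Variable K : forall U, set 'M[sec U]_n.
Hypothesis Kres : forall U V (VU : V `<=` U) (M : 'M[sec U]_n),
  K M -> K (mx_res VU M).

(** The centralizer of [K] modulo the ideal at [x]. Ranging over all smaller [W] makes it a
    subsheaf, which can be tested against the definition of [gen_algebra]; the condition is vacuous
    on open sets that miss [x]. *)
Definition germ_cent V : set (mx_sheaf X n n V) := fun M : 'M[sec V]_n =>
  forall W (WV : W `<=` V), W x -> forall N : 'M[sec W]_n, K N ->
    germ_ideal_mx (mx_res WV M *m N - N *m mx_res WV M).

Lemma germ_cent_scalar V (a : sec V) : @germ_cent V a%:M.
Proof.
move=> W WV Wx N KN; rewrite [mx_res _ _]map_scalar_mx scalar_mxC subrr.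
exact: germ_ideal_mx0.
Qed.

Lemma germ_cent0 V : @germ_cent V 0.
Proof.
move=> W WV Wx N KN.
rewrite [mx_res _ _]map_mx0 mulmx0 mul0mx subrr; exact: germ_ideal_mx0.
Qed.

Lemma germ_centP V (a : sec V) (M N : mx_sheaf X n n V) :
  germ_cent M -> germ_cent N -> germ_cent (a *: M + N).
Proof.
move=> cM cN W WV Wx T KT; rewrite (mx_resP WV).
have -> : (res WV a *: mx_res WV M + mx_res WV N) *m T -
    T *m (res WV a *: mx_res WV M + mx_res WV N) =
  res WV a *: (mx_res WV M *m T - T *m mx_res WV M) +
    (mx_res WV N *m T - T *m mx_res WV N).
  rewrite mulmxDl mulmxDr -scalemxAl -scalemxAr scalerBr opprD.
  by rewrite addrACA.
apply: germ_ideal_mxD; last exact: cN.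
by apply: germ_ideal_mxZ; exact: cM.
Qed.

Lemma germ_cent_res U V (VU : V `<=` U) (M : mx_sheaf X n n U) :
  germ_cent M -> germ_cent (mres VU M).
Proof.
move=> cM W WV Wx N KN.
by rewrite (mx_res_comp _ _ (subset_trans WV VU)); exact: cM.
Qed.

(** Only the neighbourhood given for the point [x] matters, since membership in the germ ideal may
    be tested after restriction. *)
Lemma germ_cent_local U (M : mx_sheaf X n n U) :
  (forall y, U y -> exists V (VU : V `<=` U), V y /\ germ_cent (mres VU M)) ->
  germ_cent M.
Proof.
move=> loc W WU Wx N KN.
have [V [VU [Vx cM]]] := loc x (WU _ Wx).
have IU : opI W V `<=` U by move=> y [/WU].
apply: (@germ_ideal_mx_ext _ _ (@opIl _ W V)).
have := cM _ (@opIr _ W V) (conj Wx Vx) _ (Kres (@opIl _ W V) KN).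
rewrite /= (mx_res_comp _ _ IU).
by rewrite {5}/mx_res map_mxB !map_mxM -!/(mx_res _ _) (mx_res_comp _ _ IU).
Qed.

Definition germ_centralizer : submod (mx_sheaf X n n) :=
  Submod germ_cent0 germ_centP germ_cent_res germ_cent_local.

(** The commutator with T is a derivation: [AB, T] = A [B, T] + [A, T] B. *)
Lemma germ_centM V (M N : 'M[sec V]_n) :
  germ_cent M -> germ_cent N -> germ_cent (M *m N : mx_sheaf X n n V).
Proof.
move=> cM cN W WV Wx T KT; rewrite [mx_res _ _]map_mxM -!/(mx_res _ _).
set A := mx_res WV M; set B := mx_res WV N.
have -> : A *m B *m T - T *m (A *m B) =
    A *m (B *m T - T *m B) + (A *m T - T *m A) *m B.
  by rewrite mulmxBr mulmxBl !mulmxA addrA subrK.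
apply: germ_ideal_mxD.
  by apply: germ_ideal_mxMl => //; exact: cN.
by apply: germ_ideal_mxMr => //; exact: cM.
Qed.

(** With B the inverse of A, [B, T] = - B [A, T] B. This is the inverse step of the induction over
    the free group. *)
Lemma germ_centV V (M N : 'M[sec V]_n) : M *m N = 1%:M -> N *m M = 1%:M ->
  germ_cent M -> germ_cent (N : mx_sheaf X n n V).
Proof.
move=> MN NM cM W WV Wx T KT.
set A := mx_res WV M; set B := mx_res WV N.
have AB : A *m B = 1%:M by rewrite -map_mxM MN map_mx1.
have BA : B *m A = 1%:M by rewrite -map_mxM NM map_mx1.
have -> : B *m T - T *m B = (-1) *: (B *m (A *m T - T *m A) *m B).
  rewrite mulmxBr mulmxBl !mulmxA BA mul1mx -(mulmxA _ A B) AB mulmx1.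
  by rewrite scaleN1r opprB.
apply: germ_ideal_mxZ; apply: germ_ideal_mxMr => //.
apply: germ_ideal_mxMl => //.
exact: cM.
Qed.

(** The centralizer is a subalgebra, closed under inverses, so it contains the image of the whole
    group once it contains the images of the generators; the generated algebra is the smallest such
    subalgebra. *)
Lemma gen_algebra_germ_cent (G : groupType) (I : Type) (g : I -> G)
    (rho : G -> 'M[sec (otop X)]_n) :
  free_group g -> representation rho ->
  (forall i, @germ_cent (otop X) (rho (g i))) ->
  forall V (M : 'M[sec V]_n), gen_algebra rho V M -> @germ_cent V M.
Proof.
move=> free [rho1 rhoM] cg V M gM; apply: (gM germ_centralizer).
split=> [U|h U].
  by split=> [|A B]; [exact: germ_cent_scalar|exact: germ_centM].
apply: germ_cent_res; move: h; apply: (free_group_ind _ _ _ free) => //.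
- by rewrite rho1; exact: germ_cent_scalar.
- by move=> h k ch ck; rewrite rhoM; exact: germ_centM.
- by move=> h; apply: germ_centV; rewrite -rhoM ?mulgV ?mulVg.
Qed.

End LocalIdeal.

(** * The commutator of the two generators *)

Definition commx (R : pzRingType) n (A B : 'M[R]_n) : 'M[R]_n :=
  A *m B - B *m A.

Lemma commxC (R : pzRingType) n (A B : 'M[R]_n) : commx A B = - commx B A.
Proof. by rewrite /commx opprB. Qed.

Lemma map_commx (R S : pzRingType) (f : {rmorphism R -> S}) n (A B : 'M[R]_n) :
  map_mx f (commx A B) = commx (map_mx f A) (map_mx f B).
Proof. by rewrite /commx map_mxB !map_mxM. Qed.

Lemma ord2P (P : 'I_2 -> Prop) : P 0 -> P 1 -> forall i, P i.
Proof.
move=> P0 P1 i; have [] := unliftP 0 i => [j ->|-> //].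
by rewrite (ord1 j) (_ : lift 0 0 = 1) //; apply: val_inj.
Qed.

(* If the entries of C lie in the maximal ideal at y, then all of the algebra
   is commutative modulo this ideal, whereas the matrix units E_11 and E_12 do
   not commute. The generators commute modulo the ideal, hence commute with
   the algebra, which in turn then commutes with itself. *)
Lemma commutator_unimodular (F2 : groupType) (x : 'I_2 -> F2)
    (X : ringed_space) (rho : F2 -> 'M[sec (otop X)]_2) (y : X) :
  free_group x -> Borel_rep rho ->
  let C := commx (rho (x 0)) (rho (x 1)) in
  exists (W : opens X) (a : 'M[sec W]_2),
    W y /\ \tr (a *m mx_res (@sub_otop _ W) C) = 1.
Proof.
move=> free [rep [_ equiv]] C.
pose K1 (U : opens X) : set 'M[sec U]_2 :=
  [set M | exists i, M = mx_res (@sub_otop _ U) (rho (x i))].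
pose K2 (U : opens X) : set 'M[sec U]_2 := gen_algebra rho U.
have K1res (U V : opens X) (VU : V `<=` U) (M : 'M[sec U]_2) :
    K1 U M -> K1 V (mx_res VU M).
  move=> [i ->]; exists i; exact: mx_res_comp.
have K2res (U V : opens X) (VU : V `<=` U) (M : 'M[sec U]_2) :
    K2 U M -> K2 V (mx_res VU M).
  exact: sub_res.
(* Of the four commutators of generators, two are 0 and the others are [C] and its opposite. *)
have xC i j : germ_ideal_mx C y (commx (rho (x i)) (rho (x j))).
  have C0 g : germ_ideal_mx C y (commx (rho g) (rho g)).
    by rewrite /commx subrr; exact: germ_ideal_mx0.
  move: i j; apply: ord2P; apply: ord2P => //; first exact: germ_ideal_mxC.
  by rewrite commxC -scaleN1r; apply: germ_ideal_mxZ; exact: germ_ideal_mxC.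
have gen_x : forall V (M : 'M[sec V]_2),
    gen_algebra rho V M -> germ_cent C y K1 M.
  apply: (gen_algebra_germ_cent K1res free rep) => i W WV Wy _ [j ->].
  rewrite (Prop_irrelevance WV (@sub_otop _ W)) -!map_mxM -map_mxB.
  exact: (germ_ideal_mx_res (@sub_otop _ W) Wy (xC i j)).
have gen_gen : forall V (M : 'M[sec V]_2),
    gen_algebra rho V M -> germ_cent C y K2 M.
  apply: (gen_algebra_germ_cent K2res free rep) => i W WV Wy N /gen_x.
  rewrite (Prop_irrelevance WV (@sub_otop _ W)).
  move=> /(_ W (@subset_refl _ W) Wy _ (ex_intro _ i erefl)).
  by rewrite mx_res_id => NJ; rewrite -opprB -scaleN1r; exact: germ_ideal_mxZ.
have [U [P [Q [Uy PQ QP tri]]]] := equiv y.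
(* Local equivalence with the upper triangular mold puts conjugates of the matrix units into the
   algebra. *)
have gen_E j : exists2 M, gen_algebra rho U M & M = P *m delta_mx 0 j *m Q.
  have : upper_tri_mold X 2 U (delta_mx 0 j).
    by move=> i k ki; rewrite mxE; case: (i =P 0) => // i0; rewrite i0 in ki.
  rewrite -(tri U (@subset_refl _ U)) => -[M gM]; rewrite !mx_res_id => <-.
  by exists M => //; rewrite !mulmxA PQ mul1mx -mulmxA PQ mulmx1.
have [M1 gM1 M1E] := gen_E 0; have [M2 gM2 M2E] := gen_E 1.
have := gen_gen U M1 gM1 U (@subset_refl _ U) Uy M2 gM2.
rewrite mx_res_id => /(germ_ideal_mxMl Q Uy) /(germ_ideal_mxMr P Uy) /(_ 0 1).
(* Conjugated back, this is [E_00, E_01] = E_01; its entry 1 then lies in the ideal. *)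
have -> : Q *m (M1 *m M2 - M2 *m M1) *m P = delta_mx 0 1.
  rewrite mulmxBr mulmxBl M1E M2E !mulmxA QP !mul1mx.
  rewrite -!(mulmxA _ Q P) QP !mulmx1.
  by rewrite !mul_delta_mx_cond /= mulr1n mulr0n subr0.
rewrite mxE => -[W [WU [Wy [a aE]]]]; exists W, a; split=> //.
by rewrite -aE rmorph1.
Qed.

(** The row t^T J is the linear form v -> det(v, t), so s t^T J is the endomorphism v -> det(v, t)
    s, which kills t. *)
Definition symp (R : pzRingType) : 'M[R]_2 :=
  \matrix_(i, j) (if (i < j)%N then -1 else if (j < i)%N then 1 else 0).

Lemma map_symp (R S : pzRingType) (f : {rmorphism R -> S}) :
  map_mx f (symp R) = symp S.
Proof.
apply/matrixP=> i j; rewrite !mxE.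
by case: ltngtP => _; rewrite ?rmorphN ?rmorph1 ?rmorph0.
Qed.


(* Row i of C vanishes on e, hence is r_i (e_1, - e_0), and tr C = 0 says that
   r is in turn killed by (e_1, - e_0), hence a multiple of e. *)
Lemma mxtrace0_rank_one (R : comPzRingType) (C : 'M[R]_2) (e : 'cV[R]_2)
    (w : 'rV[R]_2) :
  w *m e = 1%:M -> C *m e = 0 -> \tr C = 0 ->
  exists u, C = u *: (e *m e^T *m symp R).
Proof.
have lift1 : lift ord0 ord0 = 1 :> 'I_2 by apply: val_inj.
move=> /matrixP/(_ 0 0) + /matrixP Ce; rewrite /mxtrace.
move: (Ce 0 0) (Ce 1 0); rewrite !mxE !big_ord_recl !big_ord0.
rewrite !addr0 lift1 mulr1n.
set e0 := e 0 0; set e1 := e 1 0; set w0 := w 0 0; set w1 := w 0 1.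
move=> Ce0 Ce1 we trC.
have row a b : a * e0 + b * e1 = 0 -> exists r, a = r * e1 /\ b = - (r * e0).
  (* If (a, b) = r (e1, - e0), then pairing it with (w1, - w0) gives r, because w0 e0 + w1 e1 =
     1. *)
  move=> ab; exists (a * w1 - b * w0); split; apply: subr0_eq.
    transitivity (a * (1 - (w0 * e0 + w1 * e1)) + w0 * (a * e0 + b * e1)).
      by ring.
    by rewrite we ab; ring.
  transitivity (b * (1 - (w0 * e0 + w1 * e1)) + w1 * (a * e0 + b * e1)).
    by ring.
  by rewrite we ab; ring.
have [[r0 [C00 C01]] [r1 [C10 C11]]] := (row _ _ Ce0, row _ _ Ce1).
move: trC; rewrite [C 0 0]C00 C11 => trC.
have [|u [r1E r0E]] := row (- r1) r0; first by rewrite -trC; ring.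
(* Here - r1 = u e1 and r0 = - u e0, that is, r = - u e. *)
exists (- u); apply/matrixP; apply: ord2P; apply: ord2P;
  rewrite !(mxE, big_ord_recl, big_ord0) /= lift1 -/e0 -/e1.
- by rewrite [LHS]C00 r0E; ring.
- by rewrite [LHS]C01 r0E; ring.
- by rewrite [LHS]C10 -[r1]opprK r1E; ring.
- by rewrite [LHS]C11 -[r1]opprK r1E; ring.
Qed.

(** * Local generators of a line subbundle *)

Lemma line_subbundle_generator (X : ringed_space) n
    (L : submod (free_sheaf X n)) (y : X) :
  locally_free_rank (sub_sheaf L) 1 -> locally_free_quotient L ->
  exists (U : opens X) (e : 'cV[sec U]_n) (w : 'rV[sec U]_n),
    [/\ U y, L U e, w *m e = 1%:M
      & forall (V : opens X) (VU : V `<=` U) (s : 'cV[sec V]_n),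
          L V s -> exists a, s = a *: mx_res VU e].
Proof.
(* Near [y], the free sheaf is generated by a generator of [L] and lifts [v] of a basis [q] of the
   quotient. The row [w] consists of the coordinates of the standard vectors along the generator. *)
move=> freeL [Q [p [[pK p_epi] freeQ]]].
have [U1 [e [U1y e_basis]]] := freeL y.
have [U2 [m [q [U2y q_basis]]]] := freeQ y.
have /choice[V VP] k : exists V : opens X, V y /\ exists (VU : V `<=` U2)
    (s : 'cV[sec V]_n), p V s = mres VU (q k).
  have [V [VU [s [Vy sq]]]] := p_epi U2 (q k) y U2y.
  by exists V; split=> //; exists VU, s.
have [W0 [W0y W0V]] := finite_shrink (fun k => proj1 (VP k)).
pose U := opI U1 (opI U2 W0).
have Uy : U y by [].
have UU1 : U `<=` U1 := @opIl _ _ _.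
have UU2 : U `<=` U2 by move=> z [_ []].
have /choice[v vq] k : exists s : 'cV[sec U]_n, p U s = mres UU2 (q k).
  have [_ [VU [s sq]]] := VP k.
  have UV : U `<=` V k by move=> z [_ [_ /W0V]].
  by exists (mx_res UV s); rewrite (mhom_nat p UV) sq (mres_comp _ _ UU2).
pose e' : sub_sheaf L U := mres UU1 (e 0).
have e_gen (V' : opens X) (VU : V' `<=` U) (s : 'cV[sec V']_n) : L V' s ->
    exists a, s = a *: mx_res VU (val e').
  move=> Ls; have [a [aE _]] := e_basis V' (subset_trans VU UU1) (sub_mk Ls).
  exists (a 0); move/(congr1 val): aE; rewrite big_ord1 /= => ->.
  by rewrite (mx_res_comp _ _ (subset_trans VU UU1)).
have /choice[a aq] j : exists a : 'I_m -> sec U,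
    p U (delta_mx j 0 : 'cV_n) = \sum_k a k *: mres UU2 (q k).
  by have [a [aE _]] := q_basis U UU2 (p U (delta_mx j 0 : 'cV_n)); exists a.
have /choice[w wE] j : exists w,
    delta_mx j 0 = w *: val e' + \sum_k a j k *: v k.
  have : L U (delta_mx j 0 - \sum_k a j k *: v k : 'cV_n).
    apply/pK; rewrite linearB aq linear_sum -sumrB big1 // => k _.
    by rewrite linearZ_LR vq subrr.
  move=> /(e_gen U (@subset_refl _ U))[b bE]; exists b.
  rewrite -[LHS](subrK (\sum_k a j k *: v k)) bE.
  by rewrite mx_res_id.
pose c := \sum_j val e' j 0 * w j.
have eE : val e' = c *: val e' + \sum_k (\sum_j val e' j 0 * a j k) *: v k.
  rewrite scaler_suml [RHS](_ : _ = \sum_j val e' j 0 *: delta_mx j 0).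
    rewrite [LHS]matrix_sum_delta; apply: eq_bigr => j _.
    by rewrite big_ord1.
  under [RHS]eq_bigr => j _ do rewrite wE scalerDr scalerA scaler_sumr.
  rewrite big_split /= exchange_big /=; congr (_ + _).
  apply: eq_bigr => k _; rewrite scaler_suml.
  by apply: eq_bigr => j _; rewrite scalerA.
(* Apply [p] to [eE]: the multiples of [e'] vanish, and the [q k] are independent. *)
have b0 k : \sum_j val e' j 0 * a j k = 0.
  have := q_basis U UU2 0 => -[b [_ b_uniq]].
  transitivity (b k); last first.
    by rewrite (b_uniq (fun=> 0)) // big1 // => l _; rewrite scale0r.
  rewrite (b_uniq (fun k => \sum_j val e' j 0 * a j k)) //.
  have /pK pe : L U (val e') by exact: sub_typeP.
  have /pK pce : L U (c *: val e').
    by rewrite -[_ *: _]addr0; apply: subP; [exact: sub_typeP|exact: sub0].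
  rewrite -[LHS]pe {1}eE linearD pce add0r linear_sum.
  by apply: eq_bigr => l _; rewrite linearZ_LR vq.
(* What remains of [eE] is e' = c e', and the coordinate of [e'] in the basis of [L] is unique. *)
have c1 : c = 1.
  have [d [_ d_uniq]] := e_basis U UU1 e'.
  rewrite -(congr1 (@^~ 0) (d_uniq (fun=> c) _)); last first.
    apply: val_inj; rewrite big_ord1 {1}eE big1 ?addr0 // => k _.
    by rewrite b0 scale0r.
  apply: (congr1 (@^~ 0) (d_uniq (fun=> 1) _)).
  by rewrite big_ord1 scale1r.
exists U, (val e'), (\row_j w j); split=> //; first exact: sub_typeP.
rewrite [LHS]mx11_scalar mxE -c1; congr (_%:M).
by apply: eq_bigr => j _; rewrite mxE mulrC.
Qed.

(** * The pairing on the line bundle *)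

Lemma unimodular_cancel (X : ringed_space) n (C : 'M[sec (otop X)]_n) :
  (forall y : X, exists (W : opens X) (a : 'M[sec W]_n),
     W y /\ \tr (a *m mx_res (@sub_otop _ W) C) = 1) ->
  forall (U : opens X) (a b : sec U),
    a *: mx_res (@sub_otop _ U) C = b *: mx_res (@sub_otop _ U) C -> a = b.
Proof.
move=> uni U a b ab; apply: (@mres_eq_local _ (str_sheaf X)) => y Uy.
have [W [c [Wy c1]]] := uni y.
exists (opI U W), (@opIl _ _ _); split=> //=.
set V := opI U W.
have {}c1 : \tr (mx_res (@opIr _ U W) c *m mx_res (@sub_otop _ V) C) = 1.
  rewrite -(mx_res_comp (@sub_otop _ W) (@opIr _ U W)) -map_mxM.
  by rewrite trace_map_mx c1 rmorph1.
have {}ab : res (@opIl _ U W) a *: mx_res (@sub_otop _ V) C =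
    res (@opIl _ U W) b *: mx_res (@sub_otop _ V) C.
  have /(congr1 (mx_res (@opIl _ U W))) := ab.
  by rewrite !mx_resZ !(mx_res_comp _ _ (@sub_otop _ V)).
(* Since tr(c C) = 1, the scalar is recovered as a = tr(c (a C)). *)
rewrite -[LHS]mulr1 -[RHS]mulr1 -c1 -!mxtraceZ.
by rewrite !scalemxAr ab.
Qed.

(** As [C] cancels, the equation for [a] has at most one solution. Hence local solutions glue, and
    bilinearity and compatibility with restriction follow by cancelling [C]. *)
Lemma pairing_exists (X : ringed_space) (C : 'M[sec (otop X)]_2)
    (L : submod (free_sheaf X 2)) :
  (forall (U : opens X) (a b : sec U),
    a *: mx_res (@sub_otop _ U) C = b *: mx_res (@sub_otop _ U) C -> a = b) ->
  (forall y : X, exists U : opens X, U y /\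
     forall (V : opens X), V `<=` U ->
     forall s t : 'cV[sec V]_2, L V s -> L V t ->
       exists a, s *m t^T *m symp _ = a *: mx_res (@sub_otop _ V) C) ->
  exists b : bilin (sub_sheaf L) (sub_sheaf L) (str_sheaf X),
    forall (U : opens X) (s t : sub_sheaf L U),
      val s *m (val t)^T *m symp _ =
        (b U s t : sec U) *: mx_res (@sub_otop _ U) C.
Proof.
move=> cancelC locC.
pose rel (U : opens X) (s t : 'cV[sec U]_2) (a : sec U) :=
  s *m t^T *m symp _ = a *: mx_res (@sub_otop _ U) C.
have rel_res (U V : opens X) (VU : V `<=` U) s t a :
    rel U s t a -> rel V (mx_res VU s) (mx_res VU t) (res VU a).
  move=> /(congr1 (mx_res VU)).
  rewrite /rel mx_resZ !mx_resM [mx_res _ (symp _)]map_symp mx_res_tr.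
  by rewrite (mx_res_comp _ _ (@sub_otop _ V)).
have ex U (s t : sub_sheaf L U) : exists a : sec U, rel U (val s) (val t) a.
  (* [Q] must make sense for every [V], but restricting [s] and [t] takes a proof that [V] lies in
     [U]; so that proof is quantified inside. *)
  pose Q (V : opens X) (a : str_sheaf X V) := forall VU : V `<=` U,
    rel V (mx_res VU (val s)) (mx_res VU (val t)) a.
  have [||||a] := @mres_glue X (str_sheaf X) U Q.
  - move=> V W WV a VU Qa WU.
    rewrite -(mx_res_comp VU WV WU) -(mx_res_comp VU WV WU).
    by apply: rel_res; exact: Qa.
  - move=> V a VU Qloc VU'.
    apply: (@mres_eq_local _ (mx_sheaf X 2 2)) => y /Qloc[W [WV [Wy QW]]].
    exists W, WV; split=> //.
    have WU := subset_trans WV VU'; move: (QW WU).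
    rewrite /rel /= -(mx_res_comp VU' WV WU) -(mx_res_comp VU' WV WU).
    rewrite /= mx_resZ !mx_resM [mx_res WV (symp _)]map_symp mx_res_tr => ->.
    by rewrite (mx_res_comp _ _ (@sub_otop _ W)).
  - move=> V a b VU Qa Qb; apply: cancelC.
    by rewrite -(Qa VU) -(Qb VU).
  - move=> y Uy; have [W [Wy WC]] := locC y.
    have [|||a aE] := WC (opI U W) _ (mx_res (@opIl _ U W) (val s))
        (mx_res (@opIl _ U W) (val t)); first exact: opIr.
    + by apply: sub_res; exact: sub_typeP.
    + by apply: sub_res; exact: sub_typeP.
    exists (opI U W), a; split=> //; first exact: opIl.
    by move=> VU; rewrite (Prop_irrelevance VU (@opIl _ U W)).
  move=> /(_ (@subset_refl _ U)).
  rewrite mx_res_id.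
  by rewrite mx_res_id; exists a.
pose b U s t : str_sheaf X U := sval (cid (ex U s t)).
have bE (U : opens X) (s t : sub_sheaf L U) :
    rel U (val s) (val t) (b U s t).
  by rewrite /b; case: cid.
have bl (U : opens X) (a : sec U) (s s' t : sub_sheaf L U) :
    b U (a *: s + s') t = a *: b U s t + b U s' t.
  apply: cancelC; rewrite -bE /= scalerDl -[a *: _]/(a * _) -scalerA -!bE.
  by rewrite !mulmxDl -!scalemxAl.
have br (U : opens X) (a : sec U) (s t t' : sub_sheaf L U) :
    b U s (a *: t + t') = a *: b U s t + b U s t'.
  apply: cancelC; rewrite -bE /= scalerDl -[a *: _]/(a * _) -scalerA -!bE.
  by rewrite linearP mulmxDr mulmxDl -scalemxAr -scalemxAl.
have bn (U V : opens X) (VU : V `<=` U) (s t : sub_sheaf L U) :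
    b V (mres VU s) (mres VU t) = mres VU (b U s t).
  by apply: cancelC; rewrite -bE; apply: rel_res.
by exists (Bilin bl br bn) => U s t; exact: bE.
Qed.

(** * The structure sheaf as a tensor square *)

Section ScaleHom.
Variables (X : ringed_space) (P : mod_sheaf X) (p : P (otop X)).

(** Every morphism out of the structure sheaf has this form, with [p] the image of 1. *)
Definition scale_sec (U : opens X) (a : str_sheaf X U) : P U :=
  (a : sec U) *: mres (@sub_otop _ U) p.

Lemma scale_sec_linear (U : opens X) : linear (@scale_sec U).
Proof. by move=> a s t; rewrite /scale_sec scalerDl scalerA. Qed.

HB.instance Definition _ (U : opens X) :=
  GRing.isLinear.Build _ _ _ _ (@scale_sec U) (@scale_sec_linear U).

Lemma scale_sec_nat (U V : opens X) (VU : V `<=` U) (s : str_sheaf X U) :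
  scale_sec (mres VU s) = mres VU (scale_sec s).
Proof.
by rewrite /scale_sec mresZ (mres_comp _ _ (@sub_otop _ V)).
Qed.

Definition scale_hom : mod_hom (str_sheaf X) P :=
  @ModHom X (str_sheaf X) P (fun U => @scale_sec U) scale_sec_nat.

End ScaleHom.

Lemma mod_iso_refl (X : ringed_space) (F : mod_sheaf X) : mod_iso F F.
Proof.
pose f := @ModHom X F F (fun U => idfun) (fun _ _ _ _ => erefl).
by exists f, f.
Qed.

(* A bilinear map c is forced to be p * b, where the section p is glued from
   the sections c(e, e) / b(e, e). *)
Lemma unit_pairing_is_tensor (X : ringed_space) (F : mod_sheaf X)
    (b : bilin F F (str_sheaf X)) :
  (forall y : X, exists (U : opens X) (e : F U),
    [/\ U y, forall (V : opens X) (VU : V `<=` U) (s : F V),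
                exists a : sec V, s = a *: mres VU e
      & invertible (b U e e : sec U)]) ->
  is_tensor b.
Proof.
move=> loc P c.
have bZZ (H : mod_sheaf X) (d : bilin F F H) (U : opens X) (a a' : sec U)
    (e : F U) : d U (a *: e) (a' *: e) = (a * a') *: d U e e.
  have dl (s t : F U) (r : sec U) : d U (r *: s) t = r *: d U s t.
    have /eqP := bmap_linl d 1 0 0 t.
    rewrite !scale1r addr0 -subr_eq0 opprD addNKr oppr_eq0 => /eqP d0.
    by rewrite -[r *: s]addr0 bmap_linl d0 addr0.
  have dr (s t : F U) (r : sec U) : d U s (r *: t) = r *: d U s t.
    have /eqP := bmap_linr d 1 s 0 0.
    rewrite !scale1r addr0 -subr_eq0 opprD addNKr oppr_eq0 => /eqP d0.
    by rewrite -[r *: t]addr0 bmap_linr d0 addr0.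
  by rewrite dl dr scalerA.
pose Q (V : opens X) (p : P V) :=
  forall (W : opens X) (WV : W `<=` V) (s t : F W),
  c W s t = (b W s t : sec W) *: mres WV p.
(* Locally both sections equal d c(e, e), where d is the inverse of b(e, e). *)
have Quniq (V : opens X) (p p' : P V) : Q V p -> Q V p' -> p = p'.
  move=> Qp Qp'; apply: mres_eq_local => y Vy.
  have [U [e [Uy _ [d bd]]]] := loc y.
  exists (opI V U), (@opIl _ V U); split=> //.
  set W := opI V U; set e' := mres (@opIr _ V U) e.
  have bd' : res (@opIr _ V U) d * (b W e' e' : sec W) = 1.
    by rewrite bmap_nat /= -rmorphM mulrC bd rmorph1.
  by rewrite -[LHS]scale1r -[RHS]scale1r -bd' -!scalerA -Qp -Qp'.
have [||||p Qp] := @mres_glue X P (otop X) Q.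
- move=> V W WV p _ Qp W' W'W s t.
  by rewrite (mres_comp _ _ (subset_trans W'W WV)); exact: Qp.
- move=> V p _ Qloc W WV s t; apply: mres_eq_local => y Wy.
  have [V' [V'V [V'y Qp]]] := Qloc y (WV _ Wy).
  exists (opI W V'), (@opIl _ W V'); split=> //.
  have IV : opI W V' `<=` V by move=> z [/WV].
  rewrite -bmap_nat (Qp _ (@opIr _ W V')) (mres_comp _ _ IV) bmap_nat.
  by rewrite mresZ (mres_comp _ _ IV).
- by move=> V p p' _; exact: Quniq.
- move=> y _; have [U [e [Uy e_gen [d bd]]]] := loc y.
  exists U, (d *: c U e e); split=> // W WU s t.
  have [a ->] := e_gen W WU s; have [a' ->] := e_gen W WU t.
  rewrite !bZZ !bmap_nat mresZ scalerA; congr (_ *: _).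
  by rewrite -[RHS]/(_ * _ * _) -mulrA -rmorphM bd rmorph1 mulr1.
have cp (U : opens X) (s t : F U) : c U s t = scale_hom p U (b U s t).
  exact: Qp.
exists (scale_hom p); split=> // f fP.
(* [f] is multiplication by the image of 1, which satisfies [Q] and hence equals [p]. *)
have fE (U : opens X) (a : str_sheaf X U) :
    f U a = (a : sec U) *: mres (@sub_otop _ U) (f (otop X) (1 : sec (otop X))).
  rewrite -mhom_nat /= rmorph1.
  by rewrite -[RHS](linearZ_LR (f U)) /= [_ *: _]mulr1.
have f1 : p = f (otop X) (1 : sec (otop X)).
  apply: Quniq => // W WV s t.
  by rewrite fP fE (Prop_irrelevance WV (@sub_otop _ W)).
by apply: mod_hom_ext => U a; rewrite fE -f1.
Qed.

(** * The universal line bundle of the free group *)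

Theorem corollary4p8 (F2 : groupType) (x : 'I_2 -> F2) (hF2 : free_group x)
    (X : scheme) (rho : F2 -> 'M[sec (otop X)]_2)
    (hX : represents_Borel rho)
    (L : submod (free_sheaf X 2)) (hL : universal_sub_line_bundle rho L) :
  exists (T : mod_sheaf X) (b : bilin (sub_sheaf L) (sub_sheaf L) T),
    is_tensor b /\ mod_iso T (str_sheaf X).
Proof.
case: hX => borel _; case: hL => freeL quotL invL.
set A := rho (x 0); set B := rho (x 1).
pose C := commx A B.
have uniC y := commutator_unimodular y hF2 borel.
have cancelC := unimodular_cancel uniC.
have locC (y : X) : exists (U : opens X) (e : 'cV[sec U]_2) (u : sec U),
  [/\ U y, L U e,
    forall (V : opens X) (VU : V `<=` U) (s : 'cV[sec V]_2),
      L V s -> exists a, s = a *: mx_res VU e,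
    invertible u
    & mx_res (@sub_otop _ U) C = u *: (e *m e^T *m symp _)].
  have [U1 [e [w [U1y Le we e_gen]]]] := line_subbundle_generator y freeL quotL.
  have [U2 [a [U2y aC]]] := uniC y.
  pose U := opI U1 U2; have UU1 : U `<=` U1 := @opIl _ _ _.
  have UU2 : U `<=` U2 := @opIr _ _ _.
  have eig g : exists c, mx_res (@sub_otop _ U1) (rho g) *m e = c *: e.
    have [c cE] := e_gen U1 (@subset_refl _ U1) _ (invL g _ _ Le).
    by exists c; rewrite cE mx_res_id.
  have Ce : mx_res (@sub_otop _ U1) C *m e = 0.
    have [[c AE] [d BE]] := (eig (x 0), eig (x 1)).
    rewrite [mx_res _ _]map_commx /commx mulmxBl -!mulmxA.
    have {}AE : map_mx (res (@sub_otop _ U1)) A *m e = c *: e by [].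
    have {}BE : map_mx (res (@sub_otop _ U1)) B *m e = d *: e by [].
    by rewrite BE AE -!scalemxAr BE AE !scalerA mulrC subrr.
  have trC : \tr (mx_res (@sub_otop _ U1) C) = 0.
    by rewrite trace_map_mx /C /commx raddfB /= mxtrace_mulC subrr rmorph0.
  have [u uE] := mxtrace0_rank_one we Ce trC.
  have CU : mx_res (@sub_otop _ U) C =
      res UU1 u *: (mx_res UU1 e *m (mx_res UU1 e)^T *m symp _).
    rewrite -(mx_res_comp (@sub_otop _ U1) UU1) uE mx_resZ !mx_resM.
    by rewrite [mx_res _ (symp _)]map_symp mx_res_tr.
  exists U, (mx_res UU1 e), (res UU1 u); split=> //; first exact: sub_res.
    move=> V VU s Ls; have [c ->] := e_gen V (subset_trans VU UU1) s Ls.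
    by exists c; rewrite (mx_res_comp _ _ (subset_trans VU UU1)).
  (* Multiplying this trace by u gives tr(a C) = 1, so u is a unit. *)
  exists (\tr (mx_res UU2 a *m (mx_res UU1 e *m (mx_res UU1 e)^T *m symp _))).
  rewrite -mxtraceZ scalemxAr -CU -(mx_res_comp (@sub_otop _ U2) UU2) -mx_resM.
  by rewrite trace_map_mx aC rmorph1.
have [|b bE] := pairing_exists cancelC (L := L).
  move=> y; have [U [e [u [Uy _ e_gen [v uv] CE]]]] := locC y.
  exists U; split=> // V VU s t Ls Lt.
  have [c ->] := e_gen V VU s Ls; have [d ->] := e_gen V VU t Lt.
  (* With v the inverse of u, (c e)(d e)^T J = c d e e^T J = c d v C. *)
  exists (c * d * res VU v).
  rewrite -(mx_res_comp (@sub_otop _ U) VU) CE mx_resZ !mx_resM.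
  rewrite [mx_res _ (symp _)]map_symp mx_res_tr scalerA -!mulrA -rmorphM.
  rewrite (mulrC v) uv rmorph1 mulr1.
  by rewrite linearZ /= -scalemxAr -!scalemxAl scalerA mulrC.
exists (str_sheaf X), b; split; last exact: mod_iso_refl.
apply: unit_pairing_is_tensor => y.
have [U [e [u [Uy Le e_gen _ CE]]]] := locC y.
exists U, (sub_mk Le); split=> //.
  move=> V VU s; have [a aE] := e_gen V VU _ (sub_typeP s).
  by exists a; apply: val_inj.
(* From C = u e e^T J and e e^T J = b(e, e) C follows C = u b(e, e) C; cancelling [C] shows that u
   is the inverse of b(e, e). *)
exists u; apply: cancelC.
by rewrite scale1r {2}CE mulrC -scalerA -bE.
Qed.
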